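(* Let $\delta=\delta(n)\le 1/2$ be the deletion rate. There is an $O(n)$-time randomized algorithm which is given as input the values $n$ and $\delta$ and a single trace $y\sim\mathrm{Del}_\delta(x)$, where $x\in\{0,1\}^n$ is an arbitrary unknown source string, such that for any $\gamma\in(0,1]$ it outputs a hypothesis string $\hat{x}\in\{0,1\}^n$ satisfying $$\mathbb{E}\big[|\mathsf{LCS}(\hat{x},x)|\big]\ge\Big(1-e^{-\Omega(\gamma^2 n)}\Big)\Big(1-\delta+\frac{\delta^2}{2}-\frac{\delta^3}{2}+\frac{\delta^4}{2}-\frac{\delta^5}{2}\Big)n-3\gamma n,$$ where the expectation is over the trace and the algorithm's internal randomness, and $\Omega(\cdot)$ hides an absolute constant.
   Context: For $x\in\{0,1\}^n$ and $0<\delta<1$, the deletion channel $\mathrm{Del}_\delta(x)$ is the distribution over $\{0,1\}^{\le n}$ obtained by independently deleting each bit of $x$ with probability $\delta$ and concatenating the surviving bits; a draw from it is a trace of $x$. $|\mathsf{LCS}(u,v)|$ denotes the length of a longest common subsequence of strings $u,v$. *)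

(* Defs.v *)
From HB Require Import structures.
From mathcomp Require Import all_boot all_order all_algebra.
From mathcomp Require Import reals.

Set Implicit Arguments.
Unset Strict Implicit.
Unset Printing Implicit Defensive.

Import Order.TTheory GRing.Theory Num.Theory.

(* Every subsequence of [u] is [mask m u] for some bit mask [m] of the length
   of [u]. *)
Definition lcs (T : eqType) (u v : seq T) : nat :=
  \max_(m : (size u).-tuple bool | subseq (mask m u) v) size (mask m u).

Local Open Scope ring_scope.

(* Probability that the deletion channel maps [x] to [y]; [k] is the indicator
   of the surviving positions. *)
Definition del_prob (R : realType) (delta : R) (n : nat)
    (x : n.-tuple bool) (y : seq bool) : R :=
  \sum_(k : n.-tuple bool | mask k x == y)
    \prod_(i < n) (if tnth k i then 1 - delta else delta).

(* Model of computation: a randomized random-access machine with unit-cost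
   instructions.  It has natural-number registers, an indirectly addressed
   memory of natural numbers, real registers, and a write-only output tape of
   bits.  A program mentions finitely many registers.  Natural numbers can only
   be copied, compared, incremented and decremented, so in [t] steps no natural
   number exceeds the largest initial value or program constant by more than
   [t]; with O(n) steps all words have O(log n) bits and unit cost hides no
   arithmetic on long words.  Real registers hold exact reals (no rounding and
   no conversion from reals to natural numbers). *)
Inductive instr : Type :=
| Const of nat & nat              (* reg d := k *)
| Copy of nat & nat               (* reg d := reg s *)
| Incr of nat
| Decr of nat                     (* truncated at 0 *)
| Fetch of nat & nat              (* reg d := memory cell number (reg a) *)
| Store of nat & nat              (* memory cell number (reg a) := reg s *)
| Jump of nat
| JumpLt of nat & nat & nat       (* JumpLt a b l: if reg a < reg b goto l *)
| RConst of nat & nat             (* rreg d := k%:R *)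
| ROfNat of nat & nat             (* rreg d := (reg s)%:R *)
| RAdd of nat & nat & nat         (* rreg d := rreg a + rreg b *)
| RSub of nat & nat & nat
| RMul of nat & nat & nat
| RDiv of nat & nat & nat         (* division by 0 yields 0 *)
| RJumpLt of nat & nat & nat
| Flip of nat & nat               (* reg d := fresh coin, 1 with probability
                                     (rreg p) clipped to [0, 1], else 0 *)
| Write of nat.                   (* output the bit (reg s != 0) *)

Definition program := seq instr.

Record state (R : realType) := State {
  pc : nat;
  reg : nat -> nat;
  memory : nat -> nat;
  rreg : nat -> R;
  output : seq bool
}.

Section Semantics.
Variable R : realType.
Implicit Type s : state R.

Definition goto s l := State l (reg s) (memory s) (rreg s) (output s).
Definition next s := goto s (pc s).+1.
Definition set_reg s d v :=
  State (pc s).+1 [eta reg s with d |-> v] (memory s) (rreg s) (output s).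
Definition set_mem s a v :=
  State (pc s).+1 (reg s) [eta memory s with a |-> v] (rreg s) (output s).
Definition set_rreg s d v :=
  State (pc s).+1 (reg s) (memory s) [eta rreg s with d |-> v] (output s).
Definition write s b :=
  State (pc s).+1 (reg s) (memory s) (rreg s) (rcons (output s) b).

Definition clip01 (p : R) : R := Num.min 1 (Num.max 0 p).

(* A finitely supported distribution on states is a list of weighted states. *)
Definition exec (i : instr) s : seq (R * state R) :=
  match i with
  | Const d k => [:: (1, set_reg s d k)]
  | Copy d a => [:: (1, set_reg s d (reg s a))]
  | Incr d => [:: (1, set_reg s d (reg s d).+1)]
  | Decr d => [:: (1, set_reg s d (reg s d).-1)]
  | Fetch d a => [:: (1, set_reg s d (memory s (reg s a)))]
  | Store a b => [:: (1, set_mem s (reg s a) (reg s b))]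
  | Jump l => [:: (1, goto s l)]
  | JumpLt a b l =>
      [:: (1, if (reg s a < reg s b)%N then goto s l else next s)]
  | RConst d k => [:: (1, set_rreg s d k%:R)]
  | ROfNat d a => [:: (1, set_rreg s d (reg s a)%:R)]
  | RAdd d a b => [:: (1, set_rreg s d (rreg s a + rreg s b))]
  | RSub d a b => [:: (1, set_rreg s d (rreg s a - rreg s b))]
  | RMul d a b => [:: (1, set_rreg s d (rreg s a * rreg s b))]
  | RDiv d a b =>
      [:: (1, set_rreg s d (if rreg s b == 0 then 0 else rreg s a / rreg s b))]
  | RJumpLt a b l =>
      [:: (1, if rreg s a < rreg s b then goto s l else next s)]
  | Flip d p => let q := clip01 (rreg s p) in
      [:: (q, set_reg s d 1%N); (1 - q, set_reg s d 0%N)]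
  | Write a => [:: (1, write s (reg s a != 0%N))]
  end.

(* The machine halts when the program counter leaves the program. *)
Definition halted (A : program) s : bool := (size A <= pc s)%N.

Definition step (A : program) s : seq (R * state R) :=
  if onth A (pc s) is Some i then exec i s else [:: (1, s)].

Fixpoint run (A : program) (t : nat) s : seq (R * state R) :=
  if t is t'.+1 then
    [seq (ps.1 * qs.1, qs.2) | ps <- step A s, qs <- run A t' ps.2]
  else [:: (1, s)].

(* Input convention: n and the length of y are in natural registers 0 and 1,
   the bits of y are in memory cells 0, 1, ..., and delta is in real
   register 0. *)
Definition init (n : nat) (delta : R) (y : seq bool) : state R :=
  State 0 (nth 0%N [:: n; size y]) (nth 0%N (map nat_of_bool y))
    (nth 0 [:: delta]) [::].

(* With probability one over its coins, [A] on input (n, delta, y) halts within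
   [t] steps and outputs a string of length n. *)
Definition halts_within (A : program) (n : nat) (delta : R) (y : seq bool)
    (t : nat) : bool :=
  all (fun ps => (0 < ps.1) ==> halted A ps.2 && (size (output ps.2) == n))
    (run A t (init n delta y)).

(* Probability that [A] on input (n, delta, y) halts within [t] steps with
   output [z]. *)
Definition output_prob (A : program) (n : nat) (delta : R) (y : seq bool)
    (t : nat) (z : seq bool) : R :=
  \sum_(ps <- run A t (init n delta y)
        | halted A ps.2 && (output ps.2 == z)) ps.1.

(* E |LCS(z, x)| over a trace y of x and an output z of [A] on
   input (n, delta, y). *)
Definition expected_lcs (A : program) (n : nat) (delta : R)
    (x : n.-tuple bool) (t : nat) : R :=
  \sum_(y : n.-bseq bool) del_prob delta x y *
    \sum_(z : n.-tuple bool) output_prob A n delta y t z * (lcs z x)%:R.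

End Semantics.

(* Main.v *)
Require Import Defs.
From mathcomp Require Import all_boot all_order all_algebra.
From mathcomp Require Import reals sequences exp.
From mathcomp Require Import ring lra zify.
Set Implicit Arguments.
Unset Strict Implicit.
Unset Printing Implicit Defensive.

Import Order.TTheory GRing.Theory Num.Theory.
Local Open Scope ring_scope.

(** With [m] trace bits and [d = n - m] missing ones, insert one uniform bit in
   front of a trace bit with probability [min 1 (d / m)], chosen sequentially so
   that at most [d] bits are inserted, and pad at the end.  All trace bits match
   [x]; moreover, an inserted bit that falls in a gap where [x] lost something
   matches with probability 1/2.  So the expected LCS given the deletion pattern
   is at least [m + min 1 (d / m) * G / 2], where [G] is the number of trace bits
   preceded by a deletion.  Bounding [min 1 (d / m)] below by a quadratic
   polynomial in [d / n] reduces the expectation to the moments [E G],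
   [E (G * (d - E d))] and [E (d - E d)^2], and the total loss is at most 1/4.
   A constant loss is absorbed by [3 * gamma * n] if [gamma * n >= 1/12], and by
   the factor [1 - exp (- gamma^2 * n)] otherwise. *)

(* Register 0 holds the number of output bits still to be written, register 1
   the number of unread trace bits, register 2 the read position, and register 3
   stays 0.  Line 0 is the loop head, lines 1-5 pad, lines 6-12 decide whether to
   insert, lines 13-18 insert, and lines 19-24 copy a trace bit. *)
Definition guess_prog : program :=
  [:: JumpLt 3 1 6;
      JumpLt 3 0 3; Jump 25; Write 3; Decr 0; Jump 1;
      ROfNat 1 0; ROfNat 2 1; RSub 1 1 2; RDiv 1 1 2; Flip 4 1;
      JumpLt 3 4 13; Jump 19;
      RConst 1 1; RConst 2 2; RDiv 1 1 2; Flip 4 1; Write 4; Decr 0;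
      Fetch 4 2; Write 4; Decr 0; Decr 1; Incr 2; Jump 0].

(** * Expectations over runs of the machine *)

Definition run_expect (R : realType) (A : program) (t : nat) (s : state R)
    (F : state R -> R) : R :=
  \sum_(ps <- run A t s) ps.1 * F ps.2.

Lemma run_expectS (R : realType) A t (s : state R) F :
  run_expect A t.+1 s F = \sum_(ps <- step A s) ps.1 * run_expect A t ps.2 F.
Proof.
rewrite /run_expect /= big_allpairs_dep; apply: eq_bigr => ps _.
by rewrite mulr_sumr; apply: eq_bigr => qs _; rewrite mulrA.
Qed.

Lemma run_expect_det {R : realType} A t (s s' : state R) F :
  step A s = [:: (1, s')] -> run_expect A t.+1 s F = run_expect A t s' F.
Proof. by move=> e; rewrite run_expectS e big_seq1 mul1r. Qed.

Lemma run_expect_flip {R : realType} A t (s s1 s0 : state R) p F :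
  step A s = [:: (p, s1); (1 - p, s0)] ->
  run_expect A t.+1 s F = p * run_expect A t s1 F + (1 - p) * run_expect A t s0 F.
Proof. by move=> e; rewrite run_expectS e big_cons big_seq1. Qed.

Lemma run_expect_halted (R : realType) A t (s : state R) F :
  halted A s -> run_expect A t s F = F s.
Proof.
move=> hs; elim: t => [|t IH]; first by rewrite /run_expect /= big_seq1 mul1r.
by rewrite (@run_expect_det _ _ _ _ s) // /step onth_default.
Qed.

Lemma clip01_ge0 (R : realType) (p : R) : 0 <= clip01 p.
Proof. by rewrite /clip01 le_min ler01 le_max lexx. Qed.

Lemma clip01_le1 (R : realType) (p : R) : clip01 p <= 1.
Proof. by rewrite /clip01 ge_min lexx. Qed.

Lemma clip01_id (R : realType) (p : R) : 0 <= p <= 1 -> clip01 p = p.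
Proof. by case/andP=> p0 p1; rewrite /clip01 (max_idPr p0) (min_idPr p1). Qed.

Lemma run_ge0 (R : realType) A t (s : state R) :
  all (fun ps => 0 <= ps.1) (run A t s).
Proof.
elim: t s => [|t IH] s /=; first by rewrite ler01.
have : all (fun ps => 0 <= ps.1) (step A s).
  rewrite /step; case: onth => [[]|] * /=; rewrite ?ler01 //.
  by rewrite clip01_ge0 subr_ge0 clip01_le1.
elim: (step A s) => //= ps l IHl /andP[p0 /IHl l0].
rewrite all_cat l0 andbT all_map.
by apply: sub_all (IH ps.2) => qs q0 /=; rewrite mulr_ge0.
Qed.

(** * Output distribution of the program *)

(* The expectation of [F] over the output of [guess_prog] when [N] bits are still
   to be written and [y] is still to be read. *)
Fixpoint gen_expect {R : realType} (N : nat) (y : seq bool) (F : seq bool -> R) : R :=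
  if y is c :: y' then
    let p := clip01 ((N%:R - (size y)%:R) / (size y)%:R) in
    p * (2^-1 * gen_expect N.-2 y' (fun z => F [:: true, c & z]) +
         2^-1 * gen_expect N.-2 y' (fun z => F [:: false, c & z])) +
    (1 - p) * gen_expect N.-1 y' (fun z => F (c :: z))
  else F (nseq N false).

Lemma gen_expect_ext (R : realType) N y (F F' : seq bool -> R) :
  F =1 F' -> gen_expect N y F = gen_expect N y F'.
Proof.
elim: y N F F' => [|c y IH] N F F' e /=; first exact: e.
by rewrite !(IH _ _ _ (fun z => e _)).
Qed.

(** Four instructions per padding bit and two to leave the program; since a halted state no longer
    changes, any larger [t] will do. *)
Lemma run_expect_pad (R : realType) (F : state R -> R) Fo (rg mem : nat -> nat) rr o N t :
    (forall s, halted guess_prog s -> F s = Fo (output s)) ->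
    rg 0%N = N -> rg 3%N = 0%N -> (4 * N + 2 <= t)%N ->
  run_expect guess_prog t (State 1 rg mem rr o) F = Fo (o ++ nseq N false).
Proof.
move=> FE; elim: N rg o t => [|N IH] rg o t r0 r3 tN.
  have -> : t = (t - 2).+2 by lia.
  by do 2! (erewrite run_expect_det; last by rewrite /step /= ?r0 ?r3 /=; reflexivity);
    rewrite run_expect_halted // FE //= cats0.
have -> : t = (t - 4).+4 by lia.
do 4! (erewrite run_expect_det; last by rewrite /step /= ?r0 ?r3 /=; reflexivity).
rewrite /goto /= IH /= ?r0 //; last by lia.
by rewrite -cats1 -catA.
Qed.

(** A round executes at most 19 instructions, and the last loop test with the padding takes
    [4 * N + 3]. The truncated decrements of register 0 are the [N.-1] and [N.-2] of
    [gen_expect]. *)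
Lemma run_expect_loop (R : realType) (F : state R -> R) Fo (rg mem : nat -> nat) rr o N y t :
    (forall s, halted guess_prog s -> F s = Fo (output s)) ->
    rg 0%N = N -> rg 1%N = size y -> rg 3%N = 0%N ->
    (forall j, mem (rg 2%N + j)%N = nth 0%N (map nat_of_bool y) j) ->
    (20 * size y + 4 * N + 3 <= t)%N ->
  run_expect guess_prog t (State 0 rg mem rr o) F = gen_expect N y (fun z => Fo (o ++ z)).
Proof.
move=> FE; elim: y N rg rr o t => [|c y IH] N rg rr o t r0 r1 r3 rm tN.
  have -> : t = (t.-1).+1 by lia.
  erewrite run_expect_det; last by rewrite /step /= ?r1 ?r3 /=; reflexivity.
  by rewrite /next /goto /= (@run_expect_pad _ _ Fo _ _ _ _ N) //; move: tN => /=; lia.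
have c0 (q : nat -> nat) : q 2%N = rg 2%N -> mem (q 2%N) = c.
  by move=> ->; rewrite -[rg 2%N]addn0 rm.
have cN : (nat_of_bool c != 0%N) = c by case: (c).
(* Copying a trace bit, common to the branches with and without insertion. *)
have tail N' (rg' : nat -> nat) rr' o' t' : rg' 0%N = N' -> rg' 1%N = (size y).+1 ->
    rg' 2%N = rg 2%N -> rg' 3%N = 0%N -> (20 * size y + 4 * N' + 9 <= t')%N ->
  run_expect guess_prog t' (State 19 rg' mem rr' o') F =
    gen_expect N'.-1 y (fun z => Fo (o' ++ c :: z)).
  move=> r0' r1' r2' r3' tN'; have -> : t' = (t' - 6).+2.+4 by lia.
  do 6! (erewrite run_expect_det; last by rewrite /step /=; reflexivity).
  rewrite /goto /= (IH N'.-1) /= ?r0' ?r1' ?r2' ?r3' //; last 2 first.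
  - by move=> j; rewrite addSnnS rm.
  - by lia.
  by rewrite -r2' c0 // cN; apply: gen_expect_ext => z; rewrite -cats1 -catA.
have -> : t = (t - 6).+2.+4 by move: tN => /=; lia.
have uE : (20 * size y + 4 * N + 17 <= t - 6)%N by move: tN => /=; lia.
have half : clip01 (1%:R / 2%:R : R) = 2^-1.
  by rewrite mul1r clip01_id // invr_ge0 ler0n invf_le1 ?ltr0n // ler1n.
have nz n : (n.+1%:R == 0 :> R) = false by rewrite pnatr_eq0.
do 5! (erewrite run_expect_det; last by rewrite /step /= ?r1 ?r3 /=; reflexivity).
erewrite run_expect_flip; last by rewrite /step /=; reflexivity.
rewrite /= ?r0 ?r1 nz /=.
congr (_ * _ + _ * _); last first.
  have -> : (t - 6 = (t - 8).+2)%N by lia.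
  do 2! (erewrite run_expect_det; last by rewrite /step /= ?r3 /=; reflexivity).
  by rewrite (tail N) //=; lia.
have -> : (t - 6 = (t - 13).+3.+4)%N by lia.
do 4! (erewrite run_expect_det; last by rewrite /step /= ?r3 /=; reflexivity).
erewrite run_expect_flip; last by rewrite /step /=; reflexivity.
rewrite /= nz half; 
set t' := (t - 13)%N.
have -> : 1 - 2^-1 = 2^-1 :> R by field.
have ins (b : bool) (rg' : nat -> nat) rr' : rg' 0%N = N -> rg' 1%N = (size y).+1 ->
    rg' 2%N = rg 2%N -> rg' 3%N = 0%N -> rg' 4%N = b ->
  run_expect guess_prog t'.+2 (State 17 rg' mem rr' o) F =
    gen_expect N.-2 y (fun z => Fo (o ++ [:: b, c & z])).
  move=> r0' r1' r2' r3' r4'.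
  do 2! (erewrite run_expect_det; last by rewrite /step /=; reflexivity).
  rewrite /write /set_reg /= (tail N.-1) ?r0' //=; last by rewrite /t'; lia.
  have -> : (rg' 4%N != 0%N) = b by rewrite r4'; case: (b).
  by apply: gen_expect_ext => z; rewrite -cats1 -catA.
rewrite /set_reg /=.
by rewrite (ins true) // (ins false).
Qed.

Lemma leq_lcs (T : eqType) (w u v : seq T) :
  subseq w u -> subseq w v -> (size w <= lcs u v)%N.
Proof.
case/subseqP=> m /eqP sm -> mv.
exact: (@leq_bigmax_cond _ _ (fun m : (size u).-tuple bool => size (mask m u))
  (Tuple sm)).
Qed.

Lemma lcs_attained (T : eqType) (u v : seq T) :
  exists w, [/\ subseq w u, subseq w v & size w = lcs u v].
Proof.
pose P (m : (size u).-tuple bool) := subseq (mask m u) v.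
have : (0 < #|P|)%N.
  apply/card_gt0P; exists (nseq_tuple (size u) false).
  by rewrite unfold_in /P /= mask_false sub0seq.
case/(eq_bigmax_cond (fun m : (size u).-tuple bool => size (mask m u))) => m Pm e.
by exists (mask m u); split; [exact: mask_subseq | exact: Pm | exact: esym e].
Qed.

(** Prepend [a] to an optimal common subsequence and skip [s]. *)
Lemma lcs_cons_catl (T : eqType) (a : T) s z x :
  (lcs z x < lcs (a :: z) (s ++ a :: x))%N.
Proof.
have [w [wz wx <-]] := lcs_attained z x.
apply: (@leq_lcs _ (a :: w)); first by rewrite /= eqxx.
by apply: subseq_trans (suffix_subseq s _); rewrite /= eqxx.
Qed.

Lemma lcs_consl (T : eqType) (a : T) z x : (lcs z x <= lcs (a :: z) x)%N.
Proof.
have [w [wz wx <-]] := lcs_attained z x.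
by apply: leq_lcs => //; apply: subseq_trans wz (subseq_cons _ _).
Qed.

(** * Output length and expected matches for a fixed trace *)

(** Outputs have length exactly [N]: once [N] equals the number of unread bits the coin has bias 0,
    and before that there is room for both an inserted and a copied bit. *)
Lemma gen_expect_eq0 (R : realType) N y (F : seq bool -> R) :
  (size y <= N)%N -> (forall z, size z = N -> F z = 0) -> gen_expect N y F = 0.
Proof.
elim: y N F => [|c y IH] N F yN F0 /=; first by rewrite F0 ?size_nseq.
rewrite (IH N.-1) ?mulr0 ?addr0; first last.
- by move=> z zN; apply: F0; rewrite /= zN; case: (N) yN.
- by case: (N) yN.
have [e|ne] := eqVneq N (size y).+1.
  by rewrite e subrr mul0r clip01_id ?mul0r // lexx ler01.
have ltN : ((size y).+1 < N)%N by rewrite ltn_neqAle eq_sym ne.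
by rewrite !(IH N.-2) ?mulr0 ?addr0 ?mulr0 //;
  do ?[by move=> z zN; apply: F0; rewrite /= zN; move: ltN; lia];
  move: ltN; lia.
Qed.

(** [b] is the remaining insertion budget and [r] the number of unread trace bits; the value at
    [r = 0] is 0. *)
Definition ins_prob (R : realType) (b r : nat) : R := clip01 (b%:R / r%:R).

Lemma ins_prob0 (R : realType) r : ins_prob R 0 r = 0.
Proof. by rewrite /ins_prob mul0r clip01_id // lexx ler01. Qed.

Lemma ins_prob_small (R : realType) b r :
  (b <= r)%N -> ins_prob R b r = b%:R / r%:R.
Proof.
move=> br; rewrite /ins_prob clip01_id // divr_ge0 ?ler0n //=.
case: r br => [|r] br; first by rewrite invr0 mulr0 ler01.
by rewrite ler_pdivrMr ?ltr0n // mul1r ler_nat.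
Qed.

Lemma ins_prob_large (R : realType) b r :
  (0 < r)%N -> (r <= b)%N -> ins_prob R b r = 1.
Proof.
move=> r0 rb; have : 1 <= b%:R / r%:R :> R.
  by rewrite ler_pdivlMr ?ltr0n // mul1r ler_nat.
by move=> h; rewrite /ins_prob /clip01 max_r ?min_l // (le_trans ler01).
Qed.

(* The ratio budget / remaining gaps is a martingale, which is why every gap
   receives a bit with the same probability. *)
Lemma ins_prob_martingale (R : realType) b r : (0 < r)%N ->
  ins_prob R b r.+1 * ins_prob R b.-1 r +
    (1 - ins_prob R b r.+1) * ins_prob R b r = ins_prob R b r.+1.
Proof.
move=> r0; have [rb|br] := ltnP r b.
  rewrite (@ins_prob_large _ b r.+1) // subrr mul0r addr0 mul1r.
  by rewrite ins_prob_large //; case: (b) rb.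
rewrite (@ins_prob_small _ b r.+1) ?(leq_trans br) //.
rewrite (@ins_prob_small _ b r) // ins_prob_small; last by case: (b) br => // ? /ltnW.
case: b br => [|b] br /=; first by rewrite !mul0r mulr0 addr0.
have h1 : r%:R != 0 :> R by rewrite pnatr_eq0 -lt0n.
have h2 : r.+1%:R != 0 :> R by rewrite pnatr_eq0.
have e : r.+1%:R = r%:R + 1 :> R by rewrite -addn1 natrD.
have e' : b.+1%:R = b%:R + 1 :> R by rewrite -addn1 natrD.
rewrite e in h2 *; rewrite e'; field; exact/andP.
Qed.

(* The number of surviving bits right after a deleted one; [prev] tells whether
   the bit before [k] survived. *)
Fixpoint gaps (prev : bool) (k : seq bool) : nat :=
  if k is b :: k' then (b && ~~ prev) + gaps b k' else 0.

Lemma gaps_mask prev k : (gaps prev k <= count id k)%N.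
Proof.
by elim: k prev => //= b k IH prev; apply: leq_add => //; case: b prev => [] [].
Qed.

(* [s] is the run of deleted bits of the source pending in front of [x]. *)
Lemma gen_expect_lcs_ge (R : realType) (k s x : seq bool) N (C : R)
    (F : seq bool -> R) :
    size k = size x -> (size (mask k x) <= N)%N ->
    (forall z, size z = N -> (lcs z (s ++ x))%:R + C <= F z) ->
  (size (mask k x))%:R + ins_prob R (N - size (mask k x)) (size (mask k x)) *
    (gaps (s == [::]) k)%:R / 2 + C <= gen_expect N (mask k x) F.
Proof.
elim: k s x N C F => [|b k IH] s [|a x] N C F //=.
  move=> _ _ hF; rewrite mulr0 mul0r !add0r.
  by apply: le_trans (hF _ _); rewrite ?size_nseq // lerDr ler0n.
move=> [kx]; case: b => /= [yN hF|yN hF]; last first.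
  (* A deleted bit joins the pending run, matching the flag [false] of [gaps]. *)
  rewrite add0n; have := IH (rcons s a) x N C F kx yN.
  have -> : (rcons s a == [::]) = false by case: (s).
  by apply => z zN; rewrite cat_rcons; apply: hF.
set y : seq bool := mask k x in yN IH *.
rewrite -natrB // -/(ins_prob R _ _).
set p := ins_prob _ _ _; set g := gaps true k.
have [p0 p1] : 0 <= p /\ p <= 1 by rewrite clip01_ge0 clip01_le1.
(* No insertion: [a] is matched with its own source bit, past [s], and the match is recorded in the
   additive constant. *)
have IHn : (size y)%:R + ins_prob R (N - (size y).+1) (size y) * g%:R / 2 + (C + 1)
    <= gen_expect N.-1 y (fun z => F (a :: z)).
  have -> : (N - (size y).+1 = N.-1 - size y)%N by lia.
  apply: (IH [::]) => //; first by rewrite -/y; lia.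
  move=> z zN; apply: le_trans (hF (a :: z) _); last by rewrite /= zN; lia.
  rewrite [C + 1]addrC addrA lerD2r natr1 ler_nat.
  exact: lcs_cons_catl.
(* By the martingale property, later gaps are filled with probability [p] on average over the
   current coin. With no trace bit left there are no gaps. *)
have key : ins_prob R (N - (size y).+1) (size y) * g%:R * (1 - p) +
    ins_prob R (N - (size y).+1).-1 (size y) * g%:R * p = p * g%:R.
  have [y0|y0] := posnP (size y).
    have -> : g = 0%N.
      by apply/eqP; rewrite -leqn0 -y0 size_mask // gaps_mask.
    by rewrite !mulr0 !mul0r addr0.
  have m := ins_prob_martingale R (N - (size y).+1) y0.
  by rewrite -/p in m; rewrite -[in RHS]m; ring.
have yS : (size y).+1%:R = (size y)%:R + 1 :> R by rewrite natr1.
(* With the budget exhausted the induction hypothesis does not apply to the insertion branch, but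
   that branch has weight 0. *)
have [e|ne] := eqVneq N (size y).+1.
  have pe : p = 0 by rewrite /p e subnn ins_prob0.
  move: key IHn; rewrite pe yS !mul0r !subr0 !mulr0 mulr1 addr0 => -> IHn.
  by move: IHn; rewrite mul1r; lra.
have ltN : ((size y).+1 < N)%N by rewrite ltn_neqAle eq_sym ne.
have eN : ((N - (size y).+1).-1 = N.-2 - size y)%N by lia.
have IHi (t : bool) (D : R) :
    (forall z, (lcs z x)%:R + D <= (lcs [:: t, a & z] (s ++ a :: x))%:R) ->
  (size y)%:R + ins_prob R (N - (size y).+1).-1 (size y) * g%:R / 2 + (C + D)
    <= gen_expect N.-2 y (fun z => F [:: t, a & z]).
  move=> hD; rewrite eN; apply: (IH [::]) => //; first by rewrite -/y; lia.
  move=> z zN; apply: le_trans (hF [:: t, a & z] _); last by rewrite /= zN; lia.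
  by rewrite [C + D]addrC addrA lerD2r.
have IH1 t : (size y)%:R + ins_prob R (N - (size y).+1).-1 (size y) * g%:R / 2 + (C + 1)
    <= gen_expect N.-2 y (fun z => F [:: t, a & z]).
  apply: IHi => z; rewrite natr1 ler_nat.
  exact: leq_trans (lcs_cons_catl _ _ _ _) (lcs_consl _ _ _).
set V := gen_expect N.-2 y (fun z => F [:: true, a & z]).
set W := gen_expect N.-2 y (fun z => F [:: false, a & z]).
set g' := ins_prob R _ _ * g%:R in IHi IH1 key.
set g0 := ins_prob R _ _ * g%:R in IHn key.
(* If [s] is nonempty, one of the two values of the inserted bit is its first bit and yields a
   second match; the other value costs nothing. *)
have VW : (size y)%:R + g' / 2 + (C + 1) + (s != [::])%:R / 2 <= 2^-1 * V + 2^-1 * W.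
  have := IH1 true; have := IH1 false; rewrite -/V -/W.
  case: s hF IHi => [|t s] hF IHi /=; first by lra.
  have : (size y)%:R + g' / 2 + (C + 2) <= gen_expect N.-2 y (fun z => F [:: t, a & z]).
    apply: IHi => z; rewrite -natrD ler_nat addn2.
    apply: leq_ltn_trans (lcs_cons_catl t [::] _ _).
    exact: lcs_cons_catl.
  by case: t {hF IHi}; rewrite -/V -/W; lra.
rewrite yS natrD -/g.
have h1 := ler_wpM2l p0 VW.
have q0 : 0 <= 1 - p by rewrite subr_ge0.
have h2 := ler_wpM2l q0 IHn.
apply: le_trans (lerD h1 h2).
have -> : p * ((s != [::])%:R + g%:R) = p * (s != [::])%:R + (g0 * (1 - p) + g' * p).
  by rewrite key mulrDr.
by rewrite le_eqVlt; apply/orP; left; apply/eqP; field.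
Qed.

(** * Moments of the deletion pattern *)

Definition keep_expect (R : realType) (delta : R) n (F : seq bool -> R) : R :=
  \sum_(k : n.-tuple bool)
    (\prod_(i < n) (if tnth k i then 1 - delta else delta)) * F k.

Lemma keep_expect0 (R : realType) (delta : R) F :
  keep_expect delta 0 F = F [::].
Proof.
rewrite /keep_expect (bigD1 [tuple]) //= big_ord0 mul1r.
by rewrite big_pred0 ?addr0 // => k; apply/negbF/eqP; exact: tuple0.
Qed.

Lemma keep_expectS (R : realType) (delta : R) n F :
  keep_expect delta n.+1 F =
    (1 - delta) * keep_expect delta n (fun k => F (true :: k)) +
    delta * keep_expect delta n (fun k => F (false :: k)).
Proof.
rewrite /keep_expect.
rewrite (reindex (fun bk : bool * n.-tuple bool => [tuple of bk.1 :: bk.2])) /=.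
  rewrite -(pair_big xpredT xpredT (fun b (k : n.-tuple bool) =>
    (\prod_(i < n.+1) (if tnth [tuple of b :: k] i then 1 - delta else delta))
      * F (b :: k))) /= big_bool.
  congr (_ + _); rewrite mulr_sumr; apply: eq_bigr => k _;
    rewrite big_ord_recl mulrA (tnth_nth true) /=; congr (_ * _ * _);
    by apply: eq_bigr => i _; rewrite !(tnth_nth true).
exists (fun k => (thead k, [tuple of behead k])) => [[b k] _|k _] /=.
  by rewrite theadE; congr pair; apply/val_inj.
by rewrite -tuple_eta.
Qed.

Lemma keep_expect_ext (R : realType) (delta : R) n (F F' : seq bool -> R) :
  F =1 F' -> keep_expect delta n F = keep_expect delta n F'.
Proof. by move=> e; apply: eq_bigr => k _; rewrite e. Qed.

Lemma keep_expectD (R : realType) (delta : R) n (F F' : seq bool -> R) :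
  keep_expect delta n (fun k => F k + F' k) =
    keep_expect delta n F + keep_expect delta n F'.
Proof.
by rewrite /keep_expect -big_split; apply: eq_bigr => k _; rewrite mulrDr.
Qed.

Lemma keep_expectZ (R : realType) (delta a : R) n F :
  keep_expect delta n (fun k => a * F k) = a * keep_expect delta n F.
Proof.
by rewrite /keep_expect mulr_sumr; apply: eq_bigr => k _; rewrite mulrCA.
Qed.

Lemma keep_expectC (R : realType) (delta a : R) n :
  keep_expect delta n (fun=> a) = a.
Proof.
elim: n => [|n IH]; first by rewrite keep_expect0.
by rewrite keep_expectS IH; ring.
Qed.

Lemma keep_expect_le (R : realType) (delta : R) n (F F' : seq bool -> R) :
    0 <= delta <= 1 -> (forall k, size k = n -> F k <= F' k) ->
  keep_expect delta n F <= keep_expect delta n F'.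
Proof.
case/andP=> d0 d1 FF; apply: ler_sum => k _.
apply: ler_wpM2l; last by apply: FF; rewrite size_tuple.
by apply: prodr_ge0 => i _; case: ifP => _; rewrite ?subr_ge0.
Qed.

(* [d - E d] for [d] the number of deletions in [k]. *)
Definition excess (R : realType) (delta : R) (k : seq bool) : R :=
  (count negb k)%:R - (size k)%:R * delta.

Lemma excess_cons (R : realType) (delta : R) b k :
  excess delta (b :: k) = (if b then - delta else 1 - delta) + excess delta k.
Proof. by rewrite /excess /= natrD -natr1; case: b => /=; ring. Qed.

Lemma keep_expect_excess (R : realType) (delta : R) n :
  keep_expect delta n (excess delta) = 0.
Proof.
elim: n => [|n IH]; first by rewrite keep_expect0 /excess /=; ring.
have e b : keep_expect delta n (fun k => excess delta (b :: k)) =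
    if b then - delta else 1 - delta.
  by rewrite (keep_expect_ext _ _ (excess_cons delta b)) keep_expectD
    keep_expectC IH addr0.
by rewrite keep_expectS !e; ring.
Qed.

Lemma keep_expect_excess2 (R : realType) (delta : R) n :
  keep_expect delta n (fun k => excess delta k ^+ 2) = n%:R * (delta * (1 - delta)).
Proof.
elim: n => [|n IH]; first by rewrite keep_expect0 /excess /=; ring.
have e b c : c = (if b then - delta else 1 - delta) ->
    keep_expect delta n (fun k => excess delta (b :: k) ^+ 2) =
    c ^+ 2 + n%:R * (delta * (1 - delta)).
  move=> ->; set c' := (if b then _ else _).
  rewrite (@keep_expect_ext _ _ _ _ (fun k => (c' ^+ 2 + (2 * c') * excess delta k)
    + excess delta k ^+ 2)); last by move=> k; rewrite excess_cons -/c'; ring.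
  by rewrite !keep_expectD keep_expectC keep_expectZ keep_expect_excess IH; ring.
by rewrite keep_expectS !(e _ _ erefl) -natr1; ring.
Qed.

(** Each of the [n] adjacent pairs is a deletion followed by a survival with probability
    [delta * (1 - delta)]; the flag [false] adds a gap when the first bit survives. Each case of the
    induction calls on the other. *)
Lemma keep_expect_gaps (R : realType) (delta : R) n :
  (keep_expect delta n.+1 (fun k => (gaps true k)%:R) = n%:R * (delta * (1 - delta))) /\
  (keep_expect delta n.+1 (fun k => (gaps false k)%:R) =
    n%:R * (delta * (1 - delta)) + (1 - delta)).
Proof.
elim: n => [|n [IH1 IH0]].
  by rewrite !keep_expectS !keep_expect0 /=; split; ring.
rewrite !(keep_expectS _ n.+1) /=.
rewrite (@keep_expect_ext _ _ _ (fun k => (1 + gaps true k)%:R) (fun k => 1 + (gaps true k)%:R));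
  last by move=> k; rewrite natrD.
by rewrite keep_expectD keep_expectC IH1 IH0 -natr1; split; ring.
Qed.

(** The two bits of a gap contribute [1 - 2 * delta] to the excess, and all other bits are
    independent and centred. An initial gap consists of one surviving bit, contributing
    [- delta]. *)
Lemma keep_expect_gaps_excess (R : realType) (delta : R) n :
  (keep_expect delta n.+1 (fun k => (gaps true k)%:R * excess delta k) =
    n%:R * (delta * (1 - delta) * (1 - 2 * delta))) /\
  (keep_expect delta n.+1 (fun k => (gaps false k)%:R * excess delta k) =
    n%:R * (delta * (1 - delta) * (1 - 2 * delta)) - delta * (1 - delta)).
Proof.
elim: n => [|n [IH1 IH0]].
  by rewrite !keep_expectS !keep_expect0 /excess /=; split; ring.
have [g1 g0] := keep_expect_gaps delta n.
have ex1 c p : keep_expect delta n.+1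
    (fun k => (gaps p k)%:R * (c + excess delta k)) =
    c * keep_expect delta n.+1 (fun k => (gaps p k)%:R) +
    keep_expect delta n.+1 (fun k => (gaps p k)%:R * excess delta k).
  by rewrite -keep_expectZ -keep_expectD; apply: keep_expect_ext => k; ring.
rewrite !(keep_expectS _ n.+1) /=.
rewrite (@keep_expect_ext _ _ _ _ (fun k => (gaps true k)%:R * (- delta + excess delta k)));
  last by move=> k; rewrite excess_cons.
rewrite (@keep_expect_ext _ _ _ (fun k => _ * excess delta (false :: k))
  (fun k => (gaps false k)%:R * (1 - delta + excess delta k)));
  last by move=> k; rewrite excess_cons.
rewrite (@keep_expect_ext _ _ _ (fun k => _ * excess delta (true :: k))
  (fun k => (- delta + excess delta k) + (gaps true k)%:R * (- delta + excess delta k)));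
  last by move=> k; rewrite excess_cons natrD; ring.
rewrite 2!keep_expectD keep_expectC keep_expect_excess !ex1 g1 g0 IH1 IH0 -natr1.
by split; ring.
Qed.

(** * Lower bound on the expected gain *)

(* [h u = u + u^2 - u^3] lies below [min 1 (u / (1 - u))], and its remainder
   at [delta] is [(u - delta)^2 * (1 - 2 delta - u) >= - (u - delta)^2]. *)
Lemma ins_prob_ge (R : realType) (delta : R) (d m : nat) (u := d%:R / (d + m)%:R) :
    delta <= 1 / 2 -> (0 < m)%N ->
  delta + delta ^+ 2 - delta ^+ 3 +
    (1 - delta) * (1 + 3 * delta) * (u - delta) - (u - delta) ^+ 2
  <= ins_prob R d m.
Proof.
move=> dl m0; have n0 : 0 < (d + m)%:R :> R by rewrite ltr0n addn_gt0 m0 orbT.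
have u0 : 0 <= u by rewrite divr_ge0 ?ler0n.
have mR : 0 < m%:R :> R by rewrite ltr0n.
have u1 : 1 - u = m%:R / (d + m)%:R.
  by rewrite /u natrD; field; rewrite -natrD lt0r_neq0.
have v0 : 0 < 1 - u by rewrite u1 divr_gt0.
apply: (@le_trans _ _ (u + u ^+ 2 - u ^+ 3)).
  rewrite -subr_ge0.
  have -> : u + u ^+ 2 - u ^+ 3 - (delta + delta ^+ 2 - delta ^+ 3 +
      (1 - delta) * (1 + 3 * delta) * (u - delta) - (u - delta) ^+ 2) =
    (u - delta) ^+ 2 * ((1 - u) + (1 - 2 * delta)) by ring.
  by rewrite mulr_ge0 ?sqr_ge0 //; lra.
have [md|dm] := leqP m d.
  rewrite ins_prob_large // -subr_ge0.
  have -> : 1 - (u + u ^+ 2 - u ^+ 3) = (1 - u) ^+ 2 * (1 + u) by ring.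
  by rewrite mulr_ge0 ?sqr_ge0 //; lra.
rewrite ins_prob_small ?(ltnW dm) //.
have -> : d%:R / m%:R = u / (1 - u).
  by rewrite u1 /u; field; rewrite -!natrD !lt0r_neq0.
rewrite ler_pdivlMr // -subr_ge0.
have -> : u - (u + u ^+ 2 - u ^+ 3) * (1 - u) = u ^+ 3 * (1 + (1 - u)) by ring.
by rewrite mulr_ge0 ?exprn_ge0 //; lra.
Qed.

Lemma keep_expect_gain (R : realType) (delta : R) n :
    0 < delta -> delta <= 1 / 2 ->
  (1 - delta + delta ^+ 2 / 2 - delta ^+ 3 / 2 + delta ^+ 4 / 2 - delta ^+ 5 / 2)
    * n%:R - 1 / 4
  <= keep_expect delta n (fun k => (count id k)%:R +
       ins_prob R (count negb k) (count id k) * (gaps true k)%:R / 2).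
Proof.
move=> d0 d1; case: n => [|n].
  by rewrite keep_expect0 /= !mulr0 mul0r; lra.
have [N NE] : {N : R | N = n.+1%:R} by exists n.+1%:R.
have N0 : 0 < N by rewrite NE ltr0n.
rewrite -NE.
set h := delta + delta ^+ 2 - delta ^+ 3.
(* The derivative at [delta] of the cubic whose value there is [h]. *)
set a := (1 - delta) * (1 + 3 * delta).
have a0 : 0 <= a by rewrite mulr_ge0 //; lra.
(* Pointwise minorant: [ins_prob_ge] at [u - delta = excess / N], multiplied by half the number of
   gaps, which is replaced by [N / 2] in the quadratic remainder. *)
pose L (k : seq bool) := (N - N * delta) + (-1) * excess delta k +
  h / 2 * (gaps true k)%:R + a / (2 * N) * ((gaps true k)%:R * excess delta k) +
  - (2 * N)^-1 * excess delta k ^+ 2.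
have EL : keep_expect delta n.+1 L = (N - N * delta) +
    h / 2 * (n%:R * (delta * (1 - delta))) +
    a / (2 * N) * (n%:R * (delta * (1 - delta) * (1 - 2 * delta))) -
    (2 * N)^-1 * (N * (delta * (1 - delta))).
  rewrite /L !keep_expectD !keep_expectZ !keep_expectC keep_expect_excess.
  rewrite keep_expect_excess2 -NE (keep_expect_gaps delta n).1.
  by rewrite (keep_expect_gaps_excess delta n).1; ring.
apply: (@le_trans _ _ (keep_expect delta n.+1 L)).
  rewrite EL.
  have -> : (2 * N)^-1 * (N * (delta * (1 - delta))) = delta * (1 - delta) / 2.
    by field; rewrite lt0r_neq0.
  have : 0 <= a / (2 * N) * (n%:R * (delta * (1 - delta) * (1 - 2 * delta))).
    rewrite mulr_ge0 // ?divr_ge0 // ?mulr_ge0 // ?ler0n //; lra.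
  have : n%:R = N - 1 by rewrite NE -natr1 addrK.
  move=> ->.
  set X := a / _ * _ => X0.
  have w0 : 0 <= delta * (1 - delta) by rewrite mulr_ge0 //; lra.
  have w1 : delta * (1 - delta) <= 1 / 4.
    rewrite -subr_ge0; have -> : 1 / 4 - delta * (1 - delta) = (1 / 2 - delta) ^+ 2.
      by field.
    exact: sqr_ge0.
  have h1 : h <= 1.
    rewrite -subr_ge0 (_ : 1 - h = (1 - delta) ^+ 2 * (1 + delta)); last first.
      by rewrite /h; ring.
    by rewrite mulr_ge0 ?sqr_ge0 //; lra.
  have A : 0 <= N * (delta * (1 - delta)) * (delta ^+ 2 * (1 - 2 * delta)).
    by rewrite !mulr_ge0 ?sqr_ge0 ?(ltW N0) ?(ltW d0) //; lra.
  have B : 0 <= (1 - h) * (delta * (1 - delta)).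
    by rewrite mulr_ge0 // subr_ge0.
  (* The losses are [delta * (1 - delta) / 2] from the variance and [h] times this from having only
     [N - 1] adjacent pairs; each is at most 1/8. *)
  have -> : (1 - delta + delta ^+ 2 / 2 - delta ^+ 3 / 2 + delta ^+ 4 / 2 -
     delta ^+ 5 / 2) * N - 1 / 4 = (N - N * delta) +
     h / 2 * ((N - 1) * (delta * (1 - delta))) - delta * (1 - delta) / 2
     - (1 / 4 - delta * (1 - delta)) -
     N * (delta * (1 - delta)) * (delta ^+ 2 * (1 - 2 * delta)) / 2
     - (1 - h) * (delta * (1 - delta)) / 2.
    by rewrite /h; field.
  lra.
apply: keep_expect_le => [|k kn]; first by apply/andP; split; lra.
set m := count id k; set d := count negb k; set g := (gaps true k)%:R : R.
have dm : (d + m = n.+1)%N.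
  by rewrite -kn -(count_predC id k) addnC.
have eE : excess delta k = d%:R - N * delta by rewrite /excess kn -NE.
have mE : m%:R = (N - N * delta) - excess delta k.
  by rewrite eE NE -dm natrD; ring.
rewrite mE /L -/g.
(* The empty trace has no gaps, and only the nonpositive quadratic term of [L] remains to be
   discarded. *)
have [m0|m0] := posnP m.
  have -> : g = 0.
    by have := gaps_mask true k; rewrite -/m m0 leqn0 /g => /eqP ->.
  have : 0 <= (2 * N)^-1 * excess delta k ^+ 2.
    by rewrite mulr_ge0 ?sqr_ge0 // invr_ge0 mulr_ge0 // ltW.
  by rewrite !mulr0 !mul0r !mulr0; lra.
have g0 : 0 <= g by rewrite ler0n.
have gN : g <= N.
  rewrite NE ler_nat (leq_trans (gaps_mask _ _)) // -/m -dm; exact: leq_addl.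
have := ins_prob_ge d d1 m0; rewrite dm -NE -/h -/a.
have -> : d%:R / N - delta = excess delta k / N.
  by rewrite eE; field; rewrite lt0r_neq0.
set e := excess delta k => /(ler_wpM2l g0) H.
have Q : g * (e / N) ^+ 2 <= N^-1 * e ^+ 2.
  have -> : N^-1 * e ^+ 2 = N * (e / N) ^+ 2 by field; rewrite lt0r_neq0.
  by apply: ler_wpM2r => //; apply: sqr_ge0.
have -> : a / (2 * N) * (g * e) = g * (a * (e / N)) / 2 by field; rewrite lt0r_neq0.
have -> : - (2 * N)^-1 * e ^+ 2 = - (N^-1 * e ^+ 2) / 2 by field; rewrite lt0r_neq0.
rewrite [_ * g / 2](_ : _ = g * ins_prob R d m / 2); last by ring.
set P := g * ins_prob R d m in H *.
rewrite mulrBr mulrDr in H; lra.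
Qed.

(** * Running time and expected LCS of the program *)

(** The pattern [k] determines the trace and the final state determines the output, so the sums over
    [y] and [z] each collapse to at most one term. *)
Lemma expected_lcsE (R : realType) (A : program) n (delta : R) (x : n.-tuple bool) t :
  expected_lcs A delta x t =
  keep_expect delta n (fun k => run_expect A t (init n delta (mask k x)) (fun s =>
    if halted A s && (size (output s) == n) then (lcs (output s) x)%:R else 0)).
Proof.
rewrite /expected_lcs /del_prob /keep_expect.
under eq_bigr => y _ do rewrite mulr_suml big_mkcond.
rewrite exchange_big /=; apply: eq_bigr => k _.
have ky : (size (mask k x) <= n)%N.
  by rewrite size_mask ?size_tuple // (leq_trans (count_size _ _)) ?size_tuple.
rewrite (bigD1 (Bseq ky)) //= eqxx [X in _ + X]big1 ?addr0 => [|y ne]; last first.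
  case: ifP => // /eqP e; by case/negP: ne; rewrite -val_eqE /= -e.
congr (_ * _).
rewrite /output_prob /run_expect.
under eq_bigr => z _ do rewrite mulr_suml big_mkcond.
rewrite exchange_big /=; apply: eq_bigr => -[p s] _ /=.
have [hs|hs] /= := boolP (halted A s); last by rewrite big1 ?mulr0.
have [so|so] := eqVneq (size (output s)) n.
  have so' : size (output s) == n by apply/eqP.
  rewrite (bigD1 (Tuple so')) //= eqxx [X in _ + X]big1 ?addr0 // => z ne.
  case: ifP => // /eqP e; by case/negP: ne; rewrite -val_eqE /= -e.
rewrite mulr0 big1 // => z _; case: ifP => // /eqP e.
by rewrite e size_tuple eqxx in so.
Qed.

Lemma run_expect_init (R : realType) (F : state R -> R) Fo n (delta : R) y t :
    (forall s, halted guess_prog s -> F s = Fo (output s)) ->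
    (size y <= n)%N -> (25 * n.+1 <= t)%N ->
  run_expect guess_prog t (init n delta y) F = gen_expect n y Fo.
Proof.
by move=> FE yn tn; rewrite /init (@run_expect_loop _ _ Fo _ _ _ _ n y) //=; lia.
Qed.

Lemma guess_prog_halts (R : realType) n (delta : R) (y : n.-bseq bool) t :
  (25 * n.+1 <= t)%N -> halts_within guess_prog n delta y t.
Proof.
(* Weights are nonnegative, so zero expectation of this indicator rules out every bad run of
   positive weight. *)
move=> tn; pose bad (s : state R) : R :=
  (~~ (halted guess_prog s && (size (output s) == n)))%:R.
have : run_expect guess_prog t (init n delta y) bad = 0.
  rewrite (@run_expect_init _ _ (fun z => (size z != n)%:R)) ?size_bseq //.
    by apply: gen_expect_eq0 => [|z ->]; rewrite ?size_bseq ?eqxx.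
  by move=> s hs; rewrite /bad hs.
rewrite /halts_within /run_expect; have := run_ge0 guess_prog t (init n delta y).
elim: (run _ _ _) => //= -[p s] l IH /andP[/= p0 l0]; rewrite big_cons /= => e0.
have r0 : 0 <= \sum_(j <- l) j.1 * bad j.2.
  elim: {IH e0} l l0 => [|q l IHl] /=; first by rewrite big_nil.
  case/andP=> q0 l0; rewrite big_cons addr_ge0 ?IHl // mulr_ge0 ?ler0n //.
have pb0 : 0 <= p * bad s by rewrite mulr_ge0 ?ler0n.
have [pb rb] : p * bad s = 0 /\ \sum_(j <- l) j.1 * bad j.2 = 0 by split; lra.
rewrite (IH l0 rb) andbT; apply/implyP => pp.
move/eqP: pb; rewrite mulf_eq0 gt_eqF //= /bad.
by rewrite pnatr_eq0 eqb0 negbK.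
Qed.

Lemma expected_lcs_ge (R : realType) n (delta : R) (x : n.-tuple bool) t :
    0 < delta -> delta <= 1 / 2 -> (25 * n.+1 <= t)%N ->
  (1 - delta + delta ^+ 2 / 2 - delta ^+ 3 / 2 + delta ^+ 4 / 2 - delta ^+ 5 / 2)
    * n%:R - 1 / 4 <= expected_lcs guess_prog delta x t.
Proof.
move=> d0 d1 tn; apply: le_trans (keep_expect_gain n d0 d1) _.
rewrite expected_lcsE; apply: keep_expect_le => [|k kn]; first by apply/andP; split; lra.
have kx : size k = size x by rewrite size_tuple.
have sm : size (mask k x) = count id k by rewrite size_mask.
have mn : (size (mask k x) <= n)%N by rewrite sm -kn count_size.
rewrite (@run_expect_init _ _ (fun z => if size z == n then (lcs z x)%:R else 0)) //; last first.
  by move=> s ->.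
have := @gen_expect_lcs_ge R k [::] x n 0 _ kx mn _; rewrite sm eqxx addr0.
have -> : (n - count id k = count negb k)%N.
  by rewrite -kn -(count_predC id k) addKn.
by apply=> z ->; rewrite eqxx addr0.
Qed.

Theorem theorem4p1 (R : realType) :
  exists (A : program) (C : nat) (c : R), 0 < c /\
    forall (n : nat) (delta : R), 0 < delta -> delta <= 1 / 2 ->
      (forall y : n.-bseq bool, halts_within A n delta y (C * n.+1)%N) /\
      (forall (x : n.-tuple bool) (gamma : R), 0 < gamma -> gamma <= 1 ->
         (1 - expR (- (c * gamma ^+ 2 * n%:R))) *
           (1 - delta + delta ^+ 2 / 2 - delta ^+ 3 / 2
              + delta ^+ 4 / 2 - delta ^+ 5 / 2) * n%:R
           - 3 * gamma * n%:R
         <= expected_lcs A delta x (C * n.+1)%N).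
Proof.
exists guess_prog, 25%N, 1; split=> // n delta d0 d1; split=> [y|x gamma g0 g1].
  exact: guess_prog_halts.
(* For [n = 0] the constant loss could not be absorbed, but there the claimed bound is 0. *)
case: n x => [|n] x.
  rewrite !mulr0 subr0 expected_lcsE keep_expect0.
  rewrite (@run_expect_init _ _ (fun z => if size z == 0%N then (lcs z x)%:R else 0)) //.
  by move=> s ->.
have := expected_lcs_ge x d0 d1 (leqnn _).
set f := (1 - delta + _ + _ + _ + _); set E := expected_lcs _ _ _ _ => LE.
have [N1 N0] : 1 <= n.+1%:R :> R /\ 0 <= n.+1%:R :> R by rewrite ler1n ler0n.
set N : R := n.+1%:R in LE N1 N0 *.
have f2 : 1 / 2 <= f.
  have : 0 <= delta ^+ 2 * (1 - delta) * (1 + delta ^+ 2).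
    by apply: mulr_ge0; rewrite ?addr_ge0 ?mulr_ge0 ?sqr_ge0 //; lra.
  have -> : f = 1 - delta + delta ^+ 2 * (1 - delta) * (1 + delta ^+ 2) / 2.
    by rewrite /f; field.
  lra.
have fN : 1 / 2 <= f * N by apply: (le_trans f2); rewrite ler_peMr //; lra.
set X := expR _; have X0 : 0 <= X by apply: expR_ge0.
have X1 : 1 - gamma ^+ 2 * N <= X by rewrite -[gamma ^+ 2]mul1r; apply: expR_ge1Dx.
have gN0 : 0 <= gamma * N by rewrite mulr_ge0 // ltW.
have XfN : 0 <= X * (f * N) by rewrite mulr_ge0 //; lra.
have -> : (1 - X) * f * N - 3 * gamma * N = f * N - X * (f * N) - 3 * (gamma * N).
  by ring.
(* Either [3 * gamma * N] alone covers the loss of 1/4, or [gamma * N < 1 / 12]. Then [X >= 11 / 12]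
   and [f * N >= 1 / 2], so the exponential factor gives up at least [11 / 24]. *)
have [big|small] := leP (1 / 4) (3 * (gamma * N)); first by lra.
have g2N : gamma ^+ 2 * N <= gamma * N.
  by rewrite expr2 -mulrA ler_piMl.
have : 1 / 2 * (11 / 12) <= X * (f * N).
  by rewrite [X * _]mulrC; apply: ler_pM; lra.
lra.
Qed.
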